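(* There is an absolute constant $C>0$ such that for every $p\in(0,1)$ the following holds. Let $G_p$ be the random graph on $n$ vertices in which each edge is present independently with probability $p$. Then, with probability tending to $1$ as $n\to\infty$, every decomposition tree $(T,\delta)$ of $G_p$ satisfies $$\mathrm{boolw}(T,\delta)\le C\,\frac{\ln^2 n}{p};$$ that is, almost surely any decomposition tree of $G_p$ has boolean-width $O\left(\frac{\ln^2 n}{p}\right)$.
   Context: Graphs are undirected and without loops. For a vertex subset $A\subseteq V(G)$ let $\overline{A}=V(G)\setminus A$, and for $X\subseteq A$ consider the set $N(X)\cap\overline{A}$ of vertices of $\overline{A}$ having at least one neighbor in $X$. Define $$\mathrm{cutbool}(A)=\log_2\left|\{N(X)\cap\overline{A} : X\subseteq A\}\right| ,$$ which is known to be symmetric: $\mathrm{cutbool}(A)=\mathrm{cutbool}(\overline{A})$. A decomposition tree of $G$ is a pair $(T,\delta)$ where $T$ is a tree whose internal nodes all have degree three and which has $|V(G)|$ leaves, and $\delta$ is a bijection between $V(G)$ and the leaves of $T$. Each edge of $T$ defines a cut $\{A,\overline{A}\}$ of $G$: the two parts are the vertices corresponding to the leaves of the two subtrees obtained by removing the edge. The boolean-width $\mathrm{boolw}(T,\delta)$ of the decomposition tree is the maximum of $\mathrm{cutbool}(A)$ over all cuts $\{A,\overline{A}\}$ given by edges of $T$. *)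

(* Defs.v *)
From mathcomp Require Import all_boot all_order all_algebra.
From mathcomp Require Import all_classical all_reals all_analysis.

Set Implicit Arguments.
Unset Strict Implicit.
Unset Printing Implicit Defensive.

Import Order.TTheory GRing.Theory Num.Theory.
Import numFieldNormedType.Exports.

Local Open Scope ring_scope.

Section Graphs.
Variable V : finType.

Definition pairs : {set {set V}} := [set e : {set V} | #|e| == 2%N].

(* Undirected loopless graphs on V, given by their edge sets. *)
Definition graph := {E : {set {set V}} | E \subset pairs}.

Definition edges (G : graph) : {set {set V}} := val G.

Definition adj (G : graph) : rel V := fun x y => [set x; y] \in edges G.

Definition degree (G : graph) (x : V) : nat := #|[set y | adj G x y]|.

Definition nbhd (G : graph) (X : {set V}) : {set V} :=
  [set y | [exists x in X, adj G x y]].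

(* In a symmetric irreflexive relation, a duplicate-free cycle with at most two
   elements is empty or a single edge traversed back and forth. *)
Definition is_tree (G : graph) : Prop :=
  [/\ (0 < #|V|)%N,
      forall x y, connect (adj G) x y
    & forall c : seq V, ucycle (adj G) c -> (size c <= 2)%N].

(* A single-vertex tree counts as one leaf. *)
Definition is_leaf (G : graph) (x : V) : bool := (degree G x <= 1)%N.

Definition adj_del (G : graph) (f : {set V}) : rel V :=
  fun x y => [set x; y] \in edges G :\ f.

End Graphs.

Record decomposition_tree (V : finType) := DecompositionTree {
  node : finType;
  tree : graph node;
  treeP : is_tree tree;
  internal_degree : forall t, ~~ is_leaf tree t -> degree tree t = 3%N;
  leaf_of : V -> node;
  leaf_of_inj : injective leaf_of;
  leaf_of_onto : forall t, (t \in codom leaf_of) = is_leaf tree t }.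

Section BooleanWidth.
Variables (R : realType) (V : finType) (G : graph V).

Definition cutbool (A : {set V}) : R :=
  ln #|[set nbhd G X :&: ~: A | X : {set V} in powerset A]|%:R / ln 2.

(* The vertices of G on a's side of the cut given by the tree edge {a, b}. *)
Definition tree_cut (D : decomposition_tree V) (a b : node D) : {set V} :=
  [set v | connect (adj_del (tree D) [set a; b]) a (leaf_of D v)].

(* Each tree edge is visited in both orientations, hence both sides of each cut
   are taken into account; the default value 0 is harmless as cutbool >= 0. *)
Definition boolw (D : decomposition_tree V) : R :=
  \big[Num.max/0]_(ab : node D * node D | adj (tree D) ab.1 ab.2)
    cutbool (tree_cut ab.1 ab.2).

End BooleanWidth.

Section RandomGraph.
Variables (R : realType) (n : nat) (p : R).

Definition gnp_weight (G : graph 'I_n) : R :=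
  \prod_(e in pairs 'I_n) (if e \in edges G then p else 1 - p).

(* The probability that the random graph G(n, p) lies in P. *)
Definition gnp_prob (P : set (graph 'I_n)) : R :=
  \sum_(G : graph 'I_n | G \in P) gnp_weight G.

End RandomGraph.

(* Main.v *)
Require Import Defs.
From mathcomp Require Import all_boot all_order all_algebra.
From mathcomp Require Import all_classical all_reals all_analysis.
From mathcomp Require Import ring.

Import Order.TTheory GRing.Theory Num.Theory.
Import numFieldNormedType.Exports.

(** With high probability cutbool is small on all vertex subsets A
    simultaneously, in particular on the cuts of every decomposition tree. Call
    a pair of disjoint k-sets with no edge between them a bihole of order k.

    If G has no bihole of order k, then every A has few traces N(X) :&: ~: A.
    When X has fewer than k elements, there are at most n ^ k choices for X.
    When X has at least k elements, the set of vertices of ~: A missed by N(X)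
    has fewer than k elements, since otherwise k of them, together with k
    elements of X, would form a bihole; the trace is determined by this missed
    set, so again at most n ^ k traces arise. This is [card_cut_traces]; taking
    logarithms, it bounds the boolean-width by (k + 1) ln n / ln 2
    ([boolw_no_bihole]).

    Biholes of logarithmic order are rare. A given pair of disjoint k-sets spans
    k ^ 2 potential edges, which are all absent with probability
    (1 - p) ^ (k ^ 2), so a union bound over at most n ^ (2 k) pairs gives
    probability at most (n ^ 2 (1 - p) ^ k) ^ k ([gnp_prob_has_bihole]). Once
    k >= 1 and p k >= 3 ln n, the base is at most n ^ 2 / n ^ 3 = 1 / n, and so
    is the whole ([gnp_prob_has_bihole_le]). The theorem takes k just above
    3 ln n / p. *)

Local Open Scope ring_scope.

(** * Counting subsets *)

Section Counting.
Variable V : finType.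

Lemma exists_subset_card (A : {set V}) (k : nat) :
  (k <= #|A|)%N -> exists2 B : {set V}, B \subset A & #|B| = k.
Proof.
move=> kA; have : (0 < #|[set B : {set V} | B \subset A & #|B| == k]|)%N.
  by rewrite cards_draws bin_gt0.
by case/card_gt0P=> B; rewrite inE => /andP[BA /eqP Bk]; exists B.
Qed.

Lemma leq_bin_exp n k : ('C(n, k) <= n ^ k)%N.
Proof.
apply: (@leq_trans (n ^_ k)); first by rewrite -bin_ffact leq_pmulr ?fact_gt0.
elim: k => // k IHk; rewrite ffactnSr expnSr.
by rewrite leq_mul // leq_subr.
Qed.

(** By induction on k: the 'C(#|V|, k) sets of size exactly k at most double the
    bound #|V| ^ k on the smaller ones, and #|V| >= 2 absorbs the factor 2. *)
Lemma leq_card_small_sets k : (1 < #|V|)%N ->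
  (#|[set Z : {set V} | (#|Z| < k)%N]| <= #|V| ^ k)%N.
Proof.
move=> V1; elim: k => [|k IHk].
  by rewrite expn0 eq_card0 // => Z; rewrite inE ltn0.
have -> : [set Z : {set V} | (#|Z| < k.+1)%N] =
    [set Z : {set V} | (#|Z| < k)%N] :|:
    [set Z : {set V} | Z \subset [set: V] & #|Z| == k].
  by apply/setP=> Z; rewrite !inE finset.subsetT ltnS leq_eqVlt orbC.
apply: leq_trans (leq_card_setU _ _) _.
rewrite cards_draws cardsT expnS.
apply: leq_trans (leq_mul V1 (leqnn _)).
by rewrite mul2n -addnn leq_add // leq_bin_exp.
Qed.

End Counting.

(** * Pairs of sets without edges between them *)

Section Biholes.
Variable V : finType.

Definition cross (S T : {set V}) : {set {set V}} :=
  [set [set st.1; st.2] | st in finset.setX S T].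

Definition bihole (G : graph V) (k : nat) (S T : {set V}) : bool :=
  [&& #|S| == k, #|T| == k, [disjoint S & T] & [disjoint edges G & cross S T]].

Definition has_bihole (G : graph V) (k : nat) : bool :=
  [exists ST : {set V} * {set V}, bihole G k ST.1 ST.2].

Lemma cross_pairs (S T : {set V}) :
  [disjoint S & T] -> cross S T \subset pairs V.
Proof.
move=> dST; apply/fintype.subsetP=> _ /imsetP[[x y] /setXP[xS yT] ->] /=.
rewrite inE cards2; case: (eqVneq x y) => [xy|//].
by move: yT; rewrite -xy (disjointFr dST xS).
Qed.

Lemma card_cross (S T : {set V}) :
  [disjoint S & T] -> #|cross S T| = (#|S| * #|T|)%N.
Proof.
move=> dST; rewrite -cardsX; apply: card_in_imset => -[x y] [x' y'] /=.
move=> /setXP[xS yT] /setXP[xS' yT'] eq_xy.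
have : x \in [set x'; y'] by rewrite -eq_xy set21.
have : y \in [set x'; y'] by rewrite -eq_xy set22.
rewrite !inE => /orP[/eqP yx'|/eqP ->].
  by move: yT; rewrite yx' (disjointFr dST xS').
case/orP => [/eqP -> //|/eqP xy'].
by move: xS; rewrite xy' (disjointFl dST yT').
Qed.

(** A trace is determined either by a small X or by the small part of ~: A that
    it misses, which leaves at most 2 #|V| ^ k possibilities. *)
Lemma card_cut_traces (G : graph V) (k : nat) (A : {set V}) :
  (1 < #|V|)%N -> ~~ has_bihole G k ->
  (#|[set nbhd G X :&: ~: A | X : {set V} in powerset A]| <= #|V| ^ k.+1)%N.
Proof.
move=> V1 nohole.
set small := [set Z : {set V} | (#|Z| < k)%N].
apply: (@leq_trans #|[set nbhd G X :&: ~: A | X in small] :|: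
                     [set ~: A :\: Z | Z in small]|).
  apply/subset_leq_card/fintype.subsetP=> _ /imsetP[X + ->]; rewrite inE => XA.
  rewrite inE; have [Xk|kX] := ltnP #|X| k.
    by apply/orP; left; apply/imsetP; exists X; rewrite ?inE.
  apply/orP; right; apply/imsetP; exists (~: A :\: nbhd G X); last first.
    by apply/setP=> y; rewrite !inE; case: (y \in A);
      rewrite ?andbF ?andbT ?negbK.
  rewrite inE ltnNge; apply/negP => kY.
  have [S SX Sk] := exists_subset_card _ _ _ kX.
  have [T TY Tk] := exists_subset_card _ _ _ kY.
  move/negP: nohole; apply; apply/existsP; exists (S, T) => /=.
  rewrite /bihole Sk Tk !eqxx /=; apply/andP; split.
    rewrite disjoint_subset; apply/fintype.subsetP=> x xS; rewrite inE.
    apply/negP=> /(fintype.subsetP TY).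
    by rewrite !inE (fintype.subsetP XA) ?andbF // (fintype.subsetP SX).
  rewrite disjoint_sym disjoint_subset; apply/fintype.subsetP.
  move=> _ /imsetP[[x y] /setXP[xS /(fintype.subsetP TY) yY] ->] /=.
  rewrite inE; move: yY; rewrite !inE => /andP[+ _].
  by rewrite negb_exists => /forallP/(_ x); rewrite (fintype.subsetP SX).
apply: leq_trans (leq_card_setU _ _) _; rewrite expnS.
apply: leq_trans (leq_mul V1 (leqnn _)); rewrite mul2n -addnn.
by rewrite leq_add // (leq_trans (leq_imset_card _ _)) // leq_card_small_sets.
Qed.

End Biholes.

Arguments cross {V}.
Arguments bihole {V}.
Arguments has_bihole {V}.

(** * Biholes in the random graph *)

Section Probability.
Variables (R : realType) (n : nat) (p : R).
Hypothesis p01 : 0 < p < 1.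

Lemma p_ge0 : 0 <= p. Proof. by case/andP: p01 => /ltW. Qed.

Lemma q_ge0 : 0 <= 1 - p.
Proof. by case/andP: p01 => _ /ltW; rewrite subr_ge0. Qed.

Lemma gnp_weight_ge0 (G : graph 'I_n) : 0 <= gnp_weight p G.
Proof. by apply: prodr_ge0 => e _; case: ifP => _; rewrite ?p_ge0 ?q_ge0. Qed.

Lemma gnp_prob_le (P Q : set (graph 'I_n)) :
  (P `<=` Q)%classic -> gnp_prob p P <= gnp_prob p Q.
Proof.
move=> PQ; rewrite /gnp_prob big_mkcond [leRHS]big_mkcond /=.
apply: ler_sum => G _; case: ifPn => [|_].
  by rewrite !inE => /PQ QG; rewrite mem_set.
by case: ifP => // _; exact: gnp_weight_ge0.
Qed.

(** Edges are independent: expanding the product over all potential edges e of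
    (weight of e present + weight of e absent) gives the sum of the weights of
    all the edge sets, and setting the weight of presence to 0 on F keeps those
    that avoid F. *)
Lemma gnp_prob_avoid (F : {set {set 'I_n}}) : F \subset pairs 'I_n ->
  gnp_prob p (fun G : graph 'I_n => [disjoint edges G & F]) = (1 - p) ^+ #|F|.
Proof.
move=> FP.
(* The product ranges over all sets of vertices: those that are not pairs get
   weight 0 when present and 1 when absent, hence contribute a factor 1. *)
pose present (e : {set 'I_n}) := if e \in pairs 'I_n :\: F then p else 0.
pose absent (e : {set 'I_n}) := if e \in pairs 'I_n then 1 - p else 1.
transitivity (\prod_e (present e + absent e)); last first.
  rewrite -prodr_const [RHS]big_mkcond /=; apply: eq_bigr => e _.
  rewrite /present /absent inE; have [eF|_] /= := boolP (e \in F).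
    by rewrite (fintype.subsetP FP) // add0r.
  by case: ifP => _; rewrite ?add0r // addrC subrK.
rewrite bigA_distr /=.
rewrite (bigID (fun E : {set {set 'I_n}} => E \subset pairs 'I_n :\: F)) /=.
rewrite [X in _ = _ + X]big1 ?addr0; last first.
  move=> E /subsetPn[e eE enF]; rewrite (bigD1 e) //= eE /present.
  by rewrite (negbTE enF) mul0r.
rewrite /gnp_prob (reindex_omap (val : graph 'I_n -> _) insub) /=; last first.
  by move=> E; rewrite subsetD => /andP[EP _]; rewrite insubT.
apply: eq_big => [G|G].
  rewrite valK eqxx andbT subsetD (valP G) /=.
  by rewrite (mem_setE (fun G : graph 'I_n => [disjoint edges G & F])).
rewrite inE => dGF; rewrite /gnp_weight big_mkcond /=; apply: eq_bigr => e _.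
rewrite /present /absent /edges; case: ifP => eP; case: ifP => // eG.
  by rewrite inE eP (disjointFr dGF eG).
by move: (fintype.subsetP (valP G) _ eG); rewrite eP.
Qed.

Lemma gnp_prob_setT : gnp_prob p [set: graph 'I_n]%classic = 1.
Proof.
have := gnp_prob_avoid finset.set0 (finset.sub0set _).
rewrite cards0 expr0 => <-.
congr gnp_prob; apply/seteqP; split=> G //= _.
by apply/pred0P => e /=; rewrite inE andbF.
Qed.

Lemma gnp_probC (P : set (graph 'I_n)) :
  gnp_prob p (~` P)%classic = 1 - gnp_prob p P.
Proof.
apply/eqP; rewrite eq_sym subr_eq -gnp_prob_setT /gnp_prob addrC; apply/eqP.
rewrite (eq_bigl xpredT); last by move=> G; rewrite in_setT.
rewrite (bigID (fun G : graph 'I_n => G \in P)) /=; congr (_ + _).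
by apply: eq_bigl => G; rewrite in_setC.
Qed.

(** Union bound over the pairs of k-sets, each being a bihole with probability
    at most (1 - p) ^ (k * k). *)
Lemma gnp_prob_has_bihole k :
  gnp_prob p (fun G : graph 'I_n => has_bihole G k) <=
    (n%:R ^+ 2 * (1 - p) ^+ k) ^+ k.
Proof.
pose ksets := [set S : {set 'I_n} | S \subset [set: 'I_n] & #|S| == k].
pose candidate (ST : {set 'I_n} * {set 'I_n}) :=
  (ST \in finset.setX ksets ksets) && [disjoint ST.1 & ST.2].
have union_bound : gnp_prob p (fun G : graph 'I_n => has_bihole G k) <=
    \sum_(ST | candidate ST)
      gnp_prob p (fun G : graph 'I_n => [disjoint edges G & cross ST.1 ST.2]).
  rewrite /gnp_prob (exchange_big_dep xpredT) //= big_mkcond /=.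
  apply: ler_sum => G _; case: ifPn => [|_]; last first.
    by apply: sumr_ge0 => ST _; exact: gnp_weight_ge0.
  rewrite inE => /existsP[ST /and4P[Sk Tk dST dG]].
  rewrite (bigD1 ST) /=; last first.
    rewrite /candidate inE !inE !finset.subsetT Sk Tk dST /=.
    by apply/mem_set.
  by rewrite lerDl sumr_ge0 // => *; exact: gnp_weight_ge0.
apply: le_trans union_bound _.
apply: (@le_trans _ _
  (\sum_(ST in finset.setX ksets ksets) (1 - p) ^+ (k * k))).
  rewrite [leRHS]big_mkcond [leLHS]big_mkcond /=; apply: ler_sum => ST _.
  rewrite /candidate; case: ifP => [/andP[STk dST]|_]; last first.
    by case: ifP => // _; exact/exprn_ge0/q_ge0.
  rewrite STk gnp_prob_avoid ?cross_pairs // card_cross //.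
  by move: STk; rewrite !inE => /andP[/andP[_ /eqP->] /andP[_ /eqP->]].
rewrite sumr_const cardsX cards_draws cardsT card_ord -[leLHS]mulr_natl.
rewrite exprMn -!exprM -natrX ler_wpM2r //; first exact/exprn_ge0/q_ge0.
by rewrite ler_nat mulnC expnM -mulnn leq_mul // leq_bin_exp.
Qed.

(** As 1 - p <= exp (- p), the hypothesis makes (1 - p) ^ k.+1 at most n ^ -3,
    which beats the factor n ^ 2 of the union bound. *)
Lemma gnp_prob_has_bihole_le k : (1 < n)%N -> 3 * ln n%:R <= p * k.+1%:R ->
  gnp_prob p (fun G : graph 'I_n => has_bihole G k.+1) <= n%:R^-1.
Proof.
move=> n_gt1 k_ge; apply: le_trans (gnp_prob_has_bihole _) _.
have n0 : 0 < n%:R :> R by rewrite ltr0n ltnW.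
have base_ge0 : 0 <= n%:R ^+ 2 * (1 - p) ^+ k.+1.
  by rewrite mulr_ge0 ?exprn_ge0 ?q_ge0 // ltW.
have base_le : n%:R ^+ 2 * (1 - p) ^+ k.+1 <= n%:R^-1.
  have q_le : (1 - p) ^+ k.+1 <= n%:R ^- 3.
    apply: (@le_trans _ _ (expR (- p) ^+ k.+1)).
      by rewrite lerXn2r ?nnegrE ?expR_ge0 ?q_ge0 // expR_ge1Dx.
    rewrite -expRM_natr -[n%:R]lnK ?posrE // -expRM_natl -expRN ler_expR.
    by rewrite mulNr lerN2.
  apply: le_trans (ler_wpM2l _ q_le) _; first exact/exprn_ge0/ltW.
  by rewrite (exprSr _ 2) invfM mulrA divff ?mul1r // expf_neq0 // gt_eqF.
rewrite -[leRHS]expr1; apply: le_trans (_ : (n%:R^-1) ^+ k.+1 <= _).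
  by rewrite lerXn2r ?nnegrE ?invr_ge0 // ltW.
by rewrite ler_wiXn2l ?invr_ge0 ?(ltW n0) // invf_le1 // ler1n ltnW.
Qed.

End Probability.

(** * Boolean-width and the choice of the order *)

Section Width.
Variables (R : realType) (n : nat).
Hypothesis n_gt1 : (1 < n)%N.

Lemma ln_nat_gt0 : 0 < ln n%:R :> R.
Proof. by rewrite ln_gt0 // ltr1n. Qed.

Lemma boolw_no_bihole (G : graph 'I_n) (k : nat) (D : decomposition_tree 'I_n) :
  ~~ has_bihole G k -> boolw R G D <= k.+1%:R * ln n%:R / ln 2.
Proof.
move=> nohole; have ln2 : 0 < ln 2 :> R by rewrite ln_gt0 // ltr1n.
rewrite /boolw; apply: bigmax_le => [|ab _].
  by rewrite divr_ge0 ?mulr_ge0 ?ler0n // ltW // ln_nat_gt0.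
rewrite /cutbool ler_pM2r ?invr_gt0 //.
set A := tree_cut _ _; set traces := finset.imset _ _.
have n0 : 0 < n%:R :> R by rewrite ltr0n ltnW.
have traces_gt0 : (0 < #|traces|)%N.
  apply/card_gt0P; exists (nbhd G finset.set0 :&: ~: A).
  by apply/imsetP; exists finset.set0; rewrite ?inE ?finset.sub0set.
rewrite mulr_natl -lnXn // ler_ln ?posrE ?exprn_gt0 ?ltr0n ?(ltnW n_gt1) //.
by rewrite -natrX ler_nat -[n in (n ^ _)%N]card_ord card_cut_traces ?card_ord.
Qed.

End Width.

Local Open Scope classical_set_scope.

Theorem theorem5 (R : realType) :
  exists2 C : R, 0 < C &
    forall p : R, 0 < p < 1 ->
      (fun n : nat =>
         gnp_prob p [set G : graph 'I_n |
           forall D : decomposition_tree 'I_n,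
             boolw R G D <= C * ((ln n%:R) ^+ 2 / p)])
        @ \oo --> (1 : R).
Proof.
have ln2 : 0 < ln 2 :> R by rewrite ln_gt0 // ltr1n.
(* With 1 <= k <= 3 ln n / p + 1, the bound (k + 1) ln n / ln 2 is at most
   2 k ln n / ln 2, and the summand 1 is at most (ln n / p) / ln 2 since n >= 2
   and p <= 1. *)
exists (2 * (3 + (ln 2)^-1) / ln 2) => [|p p01].
  by rewrite divr_gt0 // mulr_gt0 // addr_gt0 // invr_gt0.
have /andP[p0 p1] := p01.
apply: (squeeze_cvgr (f := fun n => 1 - n%:R^-1) (h := fun=> 1)); last 2 first.
- rewrite -[X in _ --> X]subr0; apply: cvgB; first exact: cvg_cst.
  by rewrite -cvg_shiftS; exact: cvg_harmonic.
- exact: cvg_cst.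
near=> n.
have n1 : (1 < n)%N by near: n; exact: nbhs_infty_gt.
set good := [set G | _].
have lnn : 0 < ln n%:R :> R := ln_nat_gt0 R n n1.
apply/andP; split; last first.
  by rewrite -(gnp_prob_setT R n p); exact: gnp_prob_le.
have n0 : 0 < n%:R :> R by rewrite ltr0n ltnW.
set k := (Num.trunc (3 * ln n%:R / p)).+1.
have k_ge : 3 * ln n%:R <= p * k%:R.
  by rewrite [leRHS]mulrC -ler_pdivrMr //; exact/ltW/truncnS_gt.
have k_le : k%:R <= (3 + (ln 2)^-1) * (ln n%:R / p).
  have : k%:R <= 3 * ln n%:R / p + 1.
    rewrite /k -addn1 natrD lerD2r truncn_le.
    by rewrite divr_ge0 ?mulr_ge0 // ltW.
  move/le_trans; apply.
  have ln2_le : ln 2 <= ln n%:R / p.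
    rewrite ler_pdivlMr // (@le_trans _ _ (ln 2)) //.
      by rewrite ler_piMr // ltW.
    by rewrite ler_ln ?posrE // ler_nat.
  by rewrite [leRHS]mulrDl mulrA lerD2l mulrC ler_pdivlMr // mul1r.
have bihole_rare : gnp_prob p (fun G : graph 'I_n => has_bihole G k) <= n%:R^-1.
  exact: (gnp_prob_has_bihole_le R n p p01 _ n1 k_ge).
apply: (@le_trans _ _ (1 - gnp_prob p (fun G : graph 'I_n => has_bihole G k))).
  by rewrite lerD2l lerN2.
rewrite -(gnp_probC R n p); apply: (gnp_prob_le _ n p p01) => G /negP nohole D.
apply: le_trans (boolw_no_bihole R n n1 G k D nohole) _.
rewrite [leRHS](_ : _ = 2 * ((3 + (ln 2)^-1) * (ln n%:R / p)) * ln n%:R / ln 2).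
  rewrite ler_pM2r ?invr_gt0 // ler_pM2r //.
  apply: (@le_trans _ _ (2 * k%:R)); last by rewrite ler_pM2l.
  by rewrite -natrM ler_nat mul2n -addnn -addn1 leq_add.
by field; rewrite !gt_eqF.
Unshelve. all: by end_near.
Qed.
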